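(* Let $K$ be any field and let $\mathbf Q=\mathrm{Lie}(v_0,v_1,v_2)$. Then with respect to the generating set $\{v_0,v_1,v_2\}$, $$\mathrm{GKdim}\,\mathbf Q=\underline{\mathrm{GKdim}}\,\mathbf Q=\log_\lambda 2\approx1.6518,$$ where $\lambda\approx1.5214$ is the real root of $t^3-t-2$.
   Context: $\Lambda$ is the Grassmann algebra over $K$ on odd generators $x_0,x_1,\dots$; $x_i$ acts by left multiplication; $\partial_i$ is the odd superderivation with $\partial_i(x_j)=\delta_{ij}$; pivot elements $v_i=\sum_{k\ge0}\big(\prod_{n=0}^{k-1}x_{i+3n}x_{i+3n+1}\big)\partial_{i+3k}$. $\mathbf Q$ is the Lie subsuperalgebra of $(\operatorname{End}\Lambda)^{(-)}$ generated by $v_0,v_1,v_2$ (closed also under squaring of odd elements if $\operatorname{char}K=2$). The growth function $\gamma(n)$ is the dimension of the span of all Lie monomials (commutators) in $v_0,v_1,v_2$ of length at most $n$ (in characteristic $2$ also squares of odd such monomials of length at most $n/2$); $\mathrm{GKdim}=\limsup_{n\to\infty}\ln\gamma(n)/\ln n$ and $\underline{\mathrm{GKdim}}=\liminf_{n\to\infty}\ln\gamma(n)/\ln n$. *)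

(* Defs.v *)
From HB Require Import structures.
From mathcomp Require Import all_boot all_order all_algebra.
From mathcomp Require Import finmap.
From mathcomp Require Import monalg.
From mathcomp Require Import all_classical all_reals all_analysis.

Set Implicit Arguments.
Unset Strict Implicit.
Unset Printing Implicit Defensive.

Import Order.TTheory GRing.Theory Num.Theory.
Local Open Scope ring_scope.
Local Open Scope fset_scope.

Section Grassmann.
Variable K : fieldType.

(* Λ : the Grassmann algebra on odd generators x_0, x_1, ... as a K-vector
   space, with basis the monomials x_S = x_{s1} x_{s2} ... x_{sk}
   (s1 < s2 < ... < sk) indexed by finite sets S of naturals. *)
Definition Lam := {malg K[{fset nat}]}.

Definition Op := Lam -> Lam.

Definition xmon (S : {fset nat}) : Lam := << S >>.

Definition linext (f : {fset nat} -> Lam) : Op :=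
  fun p => \sum_(S <- msupp p) p@_S *: f S.

Definition nbefore (i : nat) (S : {fset nat}) : nat :=
  count (fun s => s < i)%N (enum_fset S).

(* x_i acting by left multiplication: x_i x_S = (-1)^{#{s in S | s < i}} x_{S ∪ {i}}
   (and 0 if i ∈ S, since x_i^2 = 0). *)
Definition xop (i : nat) : Op :=
  linext (fun S => if i \in S then 0
                   else (-1) ^+ (nbefore i S) *: xmon (i |` S)).

(* ∂_i : the odd superderivation with ∂_i(x_j) = δ_ij; on monomials
   ∂_i x_S = (-1)^{#{s in S | s < i}} x_{S \ {i}} if i ∈ S, and 0 otherwise. *)
Definition dop (i : nat) : Op :=
  linext (fun S => if i \in S then (-1) ^+ (nbefore i S) *: xmon (S `\ i)
                   else 0).

Definition pref (i k : nat) : Op :=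
  foldr (fun n f => xop (i + 3 * n) \o xop (i + 3 * n).+1 \o f) id (iota 0 k).

(* pivot element v_i = sum_{k>=0} (prod_{n<k} x_{i+3n} x_{i+3n+1}) ∂_{i+3k}.
   The infinite sum is pointwise finite: on x_S only the terms with
   i + 3k ∈ S are nonzero, and these all have k <= max S. *)
Definition pivot (i : nat) : Op :=
  linext (fun S => \sum_(k < (\max_(s <- enum_fset S) s).+1)
                     pref i k (dop (i + 3 * k) (xmon S))).

Inductive lmon : Type :=
| Gen of 'I_3
| Br of lmon & lmon.

Fixpoint lmlen (t : lmon) : nat :=
  match t with Gen _ => 1%N | Br a b => (lmlen a + lmlen b)%N end.

(* supercommutator [f, g] = f g - (-1)^{|f||g|} g f for homogeneous f, g of
   parities pf, pg *)
Definition sbr (pf pg : nat) (f g : Op) : Op :=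
  fun p => f (g p) - (-1) ^+ (pf * pg) *: g (f p).

(* value of a Lie monomial in End Λ; since v_0, v_1, v_2 are odd, a Lie
   monomial of length m is homogeneous of parity m mod 2 *)
Fixpoint lmeval (t : lmon) : Op :=
  match t with
  | Gen i => pivot i
  | Br a b => sbr (lmlen a) (lmlen b) (lmeval a) (lmeval b)
  end.

Fixpoint lmons (n : nat) : seq lmon :=
  match n with
  | 0 => [::]
  | n'.+1 => [seq Gen i | i <- enum 'I_3] ++
             [seq t <- [seq Br a b | a <- lmons n', b <- lmons n']
                           | (lmlen t <= n'.+1)%N]
  end.

Definition growth_family (n : nat) : seq Op :=
  [seq lmeval t | t <- lmons n] ++
  (if (2 \in [pchar K])%N then
     [seq lmeval t \o lmeval t | t <- lmons n & odd (lmlen t) && (2 * lmlen t <= n)%N]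
   else [::]).

Definition linindep (fs : seq Op) : Prop :=
  forall c : nat -> K,
    (forall p : Lam, \sum_(i < size fs) c i *: (nth id fs i) p = 0) ->
    forall i, (i < size fs)%N -> c i = 0.

Definition dimspan (fs : seq Op) : nat :=
  \max_(m : (size fs).-tuple bool | `[< linindep (mask m fs) >]) size (mask m fs).

Definition gamma (n : nat) : nat := dimspan (growth_family n).

End Grassmann.

Definition GKdim (K : fieldType) (R : realType) : \bar R :=
  limn_esup (fun n : nat => ((ln ((gamma K n)%:R : R)) / ln (n%:R : R))%:E).

Definition lower_GKdim (K : fieldType) (R : realType) : \bar R :=
  limn_einf (fun n : nat => ((ln ((gamma K n)%:R : R)) / ln (n%:R : R))%:E).

(* Main.v *)
(* Put a_0 = a_1 = a_2 = 1, a_(n+3) = a_(n+1) + 2 a_n, the degree of v_n in the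
   generators. The recursion v_n = d_n + x_n x_(n+1) v_(n+3) gives
   v_n^2 = x_(n+1) v_(n+3) and [v_n, v_(n+1)] = - x_n v_(n+3), and it shows that the
   elements x_g v_k, with g contained in {0..k-3} or in {0..k-5} + {k-2}, span a space
   closed under brackets (and under squares in characteristic 2). Such an element has
   degree a_k - sum_(i in g) a_i >= lambda^(k-8), so at most 2^(log_lambda n + 9) of
   them have degree <= n.
   Conversely v_k is a Lie monomial of length a_k, bracketing with v_j strips the
   factor x_j, and [v_(m-2), x_g v_m] = +- x_(m-2) x_(m-1) x_g x_m v_(m+3). Hence all
   x_g v_(3q+2) with g contained in {0..3q-1} are, up to sign, Lie monomials of length
   <= a_(3q+2) <= lambda^(3q+2), and they are independent by evaluation at x_(3q+2). *)

Require Import Defs.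
From HB Require Import structures.
From mathcomp Require Import all_boot all_order all_algebra.
From mathcomp Require Import finmap monalg.
From mathcomp Require Import all_classical all_reals all_analysis.
From mathcomp Require Import zify ring lra.

Set Implicit Arguments.
Unset Strict Implicit.
Unset Printing Implicit Defensive.

Import Order.TTheory GRing.Theory Num.Theory numFieldNormedType.Exports.
Local Open Scope ring_scope.

(** * Degrees of pivots, and the admissible tails of Grassmann letters *)

Fixpoint pdeg (n : nat) : nat :=
  match n with
  | (n'.+1 as n1).+2 => pdeg n1 + 2 * pdeg n'
  | _ => 1
  end%N.

Lemma pdegE n : pdeg n.+3 = (pdeg n.+1 + 2 * pdeg n)%N.
Proof. by []. Qed.

Lemma pdeg_ind3 (P : nat -> Prop) :
  P 0%N -> P 1%N -> P 2%N -> (forall n, P n -> P n.+1 -> P n.+3) ->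
  forall n, P n.
Proof.
move=> P0 P1 P2 PS n; suff: [/\ P n, P n.+1 & P n.+2] by case.
by elim: n => [|n [Pn Pn1 Pn2]]; split=> //; apply: PS.
Qed.

(** Since every letter and pivot has odd degree, signs read off the lengths of Lie monomials agree
    with signs read off the number of odd factors. *)
Lemma odd_pdeg n : odd (pdeg n).
Proof.
elim/pdeg_ind3: n => // n _ IH.
by rewrite pdegE oddD IH oddM.
Qed.

Definition xdeg (s : seq nat) : nat := \sum_(i <- s) pdeg i.

Lemma xdeg_cat s t : xdeg (s ++ t) = (xdeg s + xdeg t)%N.
Proof. by rewrite /xdeg big_cat. Qed.

Lemma xdeg_cons i s : xdeg (i :: s) = (pdeg i + xdeg s)%N.
Proof. by rewrite /xdeg big_cons. Qed.

Lemma xdeg_nil : xdeg [::] = 0%N.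
Proof. by rewrite /xdeg big_nil. Qed.

Lemma odd_xdeg s : odd (xdeg s) = odd (size s).
Proof.
elim: s => [|i s IH]; first by rewrite xdeg_nil.
by rewrite xdeg_cons oddD IH odd_pdeg.
Qed.

(** The two alternatives come from the two ways a new head [v k] arises, with [k = n + 3]: the
    bracket of [v n] and [v n.+1] leaves the letter [n = k - 3], while the square of [v n] leaves
    [n.+1 = k - 2] next to tails that stop at [k - 5]. *)
Definition tail_shape (g : seq nat) (k : nat) :=
  all (fun i => i + 3 <= k)%N g || all (fun i => (i + 2 == k) || (i + 5 <= k))%N g.

Lemma tail_shapeW g k : tail_shape g k -> all (fun i => i + 2 <= k)%N g.
Proof.
by case/orP; apply: sub_all => i; [|case/orP=> [/eqP <- //|]]; lia.
Qed.

(** * Pivot identities derived from the commutation relations alone *)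

Section PivotAlgebra.
Variables (K : fieldType) (A : algType K) (x d v : nat -> A).
Hypothesis xx : forall i j, x i * x j = - (x j * x i).
Hypothesis xx0 : forall i, x i * x i = 0.
Hypothesis dx : forall i j, i != j -> d i * x j = - (x j * d i).
Hypothesis dx1 : forall i, d i * x i = 1 - x i * d i.
Hypothesis dd0 : forall i, d i * d i = 0.
Hypothesis vE : forall n, v n = d n + x n * x n.+1 * v n.+3.
Hypothesis vx : forall j n, (j < n)%N -> v n * x j = - (x j * v n).
Hypothesis vd : forall j n, (j < n)%N -> d j * v n + v n * d j = 0.

Definition xprod (s : seq nat) : A := \prod_(i <- s) x i.

Lemma xprod_cat s t : xprod (s ++ t) = xprod s * xprod t.
Proof. by rewrite /xprod big_cat. Qed.

Lemma xprod_cons i s : xprod (i :: s) = x i * xprod s.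
Proof. by rewrite /xprod big_cons. Qed.

Lemma xprod_nil : xprod [::] = 1.
Proof. by rewrite /xprod big_nil. Qed.

Definition passes (p : A) (s : seq nat) :=
  forall i, i \in s -> p * x i = - (x i * p).

Lemma passes_cons p i s : passes p (i :: s) -> p * x i = - (x i * p) /\ passes p s.
Proof.
move=> H; split; first by apply: H; rewrite inE eqxx.
by move=> j js; apply: H; rewrite inE js orbT.
Qed.

Lemma passes_mulx p s : passes p s -> p * xprod s = (-1) ^+ size s *: (xprod s * p).
Proof.
elim: s => [|i s IH] /=; first by rewrite xprod_nil mulr1 mul1r expr0 scale1r.
case/passes_cons=> pi /IH ps.
rewrite xprod_cons mulrA pi mulNr -(mulrA (x i) p) ps -scalerAr exprS mulN1r scaleNr.
by rewrite mulrA.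
Qed.

Lemma x_passes i s : passes (x i) s.
Proof. by move=> j _; rewrite xx. Qed.

Lemma d_passes i s : i \notin s -> passes (d i) s.
Proof. by move=> nis j js; apply: dx; apply: contraNneq nis => ->. Qed.

Lemma v_passes n s : all (fun i => i < n)%N s -> passes (v n) s.
Proof. by move=> /allP H j /H; apply: vx. Qed.

Lemma signZ_eq (V : lmodType K) e1 e2 (y : V) :
  odd e1 = odd e2 -> (-1) ^+ e1 *: y = (-1) ^+ e2 *: y.
Proof. by move=> H; rewrite -(signr_odd K e1) H signr_odd. Qed.

Lemma signZK (V : lmodType K) e (y : V) : (-1) ^+ e *: ((-1) ^+ e *: y) = y.
Proof. by rewrite scalerA -expr2 sqrr_sign scale1r. Qed.

Lemma signZD (V : lmodType K) e1 e2 (y : V) :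
  (-1) ^+ e1 *: ((-1) ^+ e2 *: y) = (-1) ^+ (e1 + e2) *: y.
Proof. by rewrite scalerA -exprD. Qed.

Lemma xprod_comm s t : xprod s * xprod t = (-1) ^+ (size s * size t) *: (xprod t * xprod s).
Proof.
elim: s => [|i s IH]; first by rewrite xprod_nil mulr1 mul1r expr0 scale1r.
rewrite xprod_cons -mulrA IH -scalerAr (mulrA (x i)) (passes_mulx (@x_passes i t)).
by rewrite -!scalerAl -!mulrA signZD /= mulSn addnC.
Qed.

Lemma xprod_nuniq s : ~~ uniq s -> xprod s = 0.
Proof.
elim: s => //= i s IH; rewrite negb_and negbK; case/orP => [|/IH]; last first.
  by rewrite xprod_cons => ->; rewrite mulr0.
case/splitPr=> s1 s2; rewrite xprod_cons xprod_cat xprod_cons mulrA.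
rewrite (passes_mulx (@x_passes i s1)) -scalerAl -mulrA (mulrA (x i)) xx0.
by rewrite mul0r mulr0 scaler0.
Qed.

(** The exponent [e] stands for the product of the two parities; only its own parity matters, so
    lengths and tail sizes can be exchanged freely. *)
Definition sbracket (e : nat) (f g : A) := f * g - (-1) ^+ e *: (g * f).

Lemma sbracket_odd e1 e2 f g :
  odd e1 = odd e2 -> sbracket e1 f g = sbracket e2 f g.
Proof. by move=> H; rewrite /sbracket (signZ_eq _ H). Qed.

Lemma sbracketDl e f f' g : sbracket e (f + f') g = sbracket e f g + sbracket e f' g.
Proof. by rewrite /sbracket mulrDl mulrDr scalerDr opprD addrACA. Qed.

Lemma sbracketDr e f g g' : sbracket e f (g + g') = sbracket e f g + sbracket e f g'.
Proof. by rewrite /sbracket mulrDl mulrDr scalerDr opprD addrACA. Qed.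

Lemma sbracketZl e c f g : sbracket e (c *: f) g = c *: sbracket e f g.
Proof. by rewrite /sbracket -scalerAl -scalerAr scalerBr !scalerA mulrC. Qed.

Lemma sbracketZr e c f g : sbracket e f (c *: g) = c *: sbracket e f g.
Proof. by rewrite /sbracket -scalerAl -scalerAr scalerBr !scalerA mulrC. Qed.

Lemma sbracket0l e g : sbracket e 0 g = 0.
Proof. by rewrite /sbracket mul0r mulr0 scaler0 subr0. Qed.

Lemma sbracket0r e g : sbracket e g 0 = 0.
Proof. by rewrite /sbracket mul0r mulr0 scaler0 subr0. Qed.

Lemma sbracketC e f g : sbracket e g f = - (-1) ^+ e *: sbracket e f g.
Proof.
by rewrite /sbracket scaleNr scalerBr signZK opprB.
Qed.

(** Moving both tails to the left costs exactly the signs of the superbracket, so the bracket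
    reduces to the anticommutator of the heads. *)
Lemma sbracket_passes s t p q : passes p t -> passes q s ->
  sbracket ((size s).+1 * (size t).+1) (xprod s * p) (xprod t * q) =
  (-1) ^+ size t *: (xprod (s ++ t) * (p * q + q * p)).
Proof.
move=> pt qs; rewrite /sbracket -!mulrA.
rewrite (mulrA p) (passes_mulx pt) (mulrA q) (passes_mulx qs).
rewrite -!scalerAl -!scalerAr !signZD !mulrA (xprod_comm t s) -!scalerAl signZD.
rewrite xprod_cat mulrDr !mulrA scalerDr; congr (_ + _).
rewrite -scaleN1r scalerA -exprS; apply: signZ_eq.
rewrite /= !(oddD, oddM, oddS) /= ?(oddD, oddM).
by case: (odd (size s)); case: (odd (size t)).
Qed.

(** Expand both factors by the recursion: [d n] squares to zero, the other summand squares to zero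
    because it repeats [x n], and the cross terms cancel except for the 1 in
    [d n * x n = 1 - x n * d n]. *)
Lemma v_sqr n : v n * v n = x n.+1 * v n.+3.
Proof.
have vxx : v n.+3 * (x n * x n.+1) = x n * x n.+1 * v n.+3.
  by rewrite mulrA vx ?mulNr -?mulrA ?vx ?mulrN ?opprK ?mulrA //; lia.
have dvn : v n.+3 * d n = - (d n * v n.+3).
  by apply/eqP; rewrite -addr_eq0 addrC vd //; lia.
rewrite {1 2}vE mulrDl !mulrDr dd0 add0r.
rewrite (mulrA (d n)) (mulrA (d n)) dx1 mulrBl mul1r.
rewrite -(mulrA (x n) (d n)) dx ?mulrN ?opprK; last by rewrite neq_ltn ltnSn.
rewrite -(mulrA (x n * x n.+1) (v n.+3)) dvn mulrN.
rewrite [X in _ + (_ + X)](_ : _ = 0) ?addr0; last first.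
  rewrite -(mulrA _ (v n.+3)) (mulrA (v n.+3)) vxx !mulrA.
  rewrite -(mulrA (x n) (x n.+1)) (xx n.+1 n) mulrN mulrA xx0.
  by rewrite !(mul0r, mulNr, oppr0).
by rewrite mulrDl !mulrA addrK.
Qed.

Lemma vx_eq n : v n * x n + x n * v n = 1.
Proof.
rewrite vE mulrDl mulrDr !mulrA xx0 !mul0r addr0.
rewrite -(mulrA (x n * _)) vx; last lia.
rewrite mulrN -(mulrA (x n)) (mulrA (x n.+1)) (xx n.+1) mulNr mulrN opprK.
by rewrite !mulrA xx0 !mul0r addr0 dx1 subrK.
Qed.

(** Multiplication by [x j] reduces [v j] to [d j], which anticommutes with [v n]. *)
Lemma x_vv j n : (j < n)%N -> x j * (v j * v n + v n * v j) = 0.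
Proof.
move=> jn; rewrite mulrDr (mulrA _ (v n)) -[x j * v n]opprK -vx //.
rewrite mulNr -mulrA (mulrA (x j)).
have -> : x j * v j = x j * d j by rewrite vE mulrDr !mulrA xx0 !mul0r addr0.
rewrite mulrA -mulNr vx // opprK -!mulrA -mulrDr vd //; exact: mulr0.
Qed.

Lemma v_anticomm_succ n : v n * v n.+1 + v n.+1 * v n = - (x n * v n.+3).
Proof.
rewrite {1 2}(vE n) mulrDl mulrDr addrACA vd // add0r.
rewrite !mulrA vx // !mulNr -!mulrA -mulrBr.
(* The 1 in [vx_eq] produces [v n.+3]; the rest combines into [x n.+1] times an anticommutator,
   which [x_vv] kills. *)
have -> : v n.+1 * (x n.+1 * v n.+3) = v n.+3 - x n.+1 * (v n.+1 * v n.+3).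
  by rewrite mulrA -{2}(mul1r (v n.+3)) -(vx_eq n.+1) mulrDl !mulrA addrK.
rewrite opprB addrA -mulrDr addrC (addrC (_ * v n.+1)) x_vv //.
by rewrite addr0 mulrN.
Qed.

(* [x j] is the only factor on which [d j] acts, so the bracket strips it. *)
Lemma sbracket_d_strip j s t n :
  all (fun i => i < n)%N s -> all (fun i => i < n)%N t -> (j < n)%N -> j \notin t ->
  sbracket ((size s).+1 * (size t).+2) (xprod s * d j) (x j * (xprod t * v n)) =
  xprod (s ++ t) * v n.
Proof.
move=> sn tn jn jt.
have sjn : passes (v n) (s ++ [:: j]) by apply: v_passes; rewrite all_cat sn /= jn.
(* With [x j * d j] in place of [d j] the bracket vanishes. This relation cancels what remains once
   [d j * x j] is replaced by [1 - x j * d j]. *)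
have := sbracket_passes (d_passes jt) sjn.
rewrite vd // mulr0 scaler0 /sbracket xprod_cat xprod_cons xprod_nil mulr1 size_cat addn1 => /eqP.
rewrite subr_eq0 => /eqP H.
rewrite (mulrA _ (x j)) -(mulrA _ (d j)) dx1 mulrBr mulr1 mulrBl mulrA.
rewrite !xprod_cat -addrA -[RHS]addr0 !mulrA; congr (_ + _).
move: H; rewrite !mulrA => ->.
apply/eqP; rewrite -opprD oppr_eq0; apply/eqP.
have -> : x j * xprod t * v n * xprod s * d j =
    (-1) ^+ ((size t).+1 + size s) *: (xprod t * v n * xprod s * x j * d j).
  have xv : x j * v n = - (v n * x j) by rewrite vx // opprK.
  rewrite (passes_mulx (@x_passes j t)) -!scalerAl -(mulrA (xprod t) (x j) (v n)) xv.
  rewrite mulrN !mulNr (mulrA (xprod t)) -(mulrA _ (x j) (xprod s)) (passes_mulx (@x_passes j s)).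
  by rewrite -scalerAr -scalerAl mulrA -scaleN1r !scalerA exprD exprSr.
rewrite signZD -scalerDl.
set e1 := (_ * _)%N; set e2 := (_ + _)%N.
suff -> : (-1) ^+ e2 = - (-1) ^+ e1 :> K by rewrite subrr scale0r.
rewrite -[RHS]mulN1r -exprS -signr_odd -[RHS]signr_odd; congr (_ ^+ _); congr nat_of_bool.
rewrite /e1 /e2 /= !(oddD, oddM, oddS) /=.
by case: (odd (size s)); case: (odd (size t)).
Qed.

(** * The span of the elements [xprod g * v k] is closed under brackets and squares *)

(** Finite linear combinations of degree [w], built term by term so that bilinear statements follow
    by induction. The degree condition is additive to avoid truncated subtraction. *)
Inductive homog (w : nat) : A -> Prop :=
| homog0 : homog w 0
| homog_add c g k y : uniq g -> tail_shape g k -> (w + xdeg g = pdeg k)%N ->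
    homog w y -> homog w (c *: (xprod g * v k) + y).

Lemma homogD w y z : homog w y -> homog w z -> homog w (y + z).
Proof.
elim=> [|c g k {}y ug gk wg _ IH]; first by rewrite add0r.
by move=> /IH; rewrite -addrA; apply: homog_add.
Qed.

Lemma homogZ w c y : homog w y -> homog w (c *: y).
Proof.
elim=> [|c' g k {}y ug gk wg _ IH]; first by rewrite scaler0; constructor.
by rewrite scalerDr scalerA; apply: homog_add.
Qed.

Lemma homogN w y : homog w y -> homog w (- y).
Proof. by rewrite -scaleN1r; apply: homogZ. Qed.

Lemma homog_xv w g k : tail_shape g k -> (w + xdeg g = pdeg k)%N ->
  homog w (xprod g * v k).
Proof.
move=> gk wg; have [ug|nug] := boolP (uniq g); last first.
  by rewrite xprod_nuniq // mul0r; constructor.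
rewrite -[_ * _]addr0 -[xprod g * _]scale1r.
by apply: homog_add => //; constructor.
Qed.

(** Induction on the gap [m.+1 - n], raising [n] by 3 through the recursion for [v n] until the
    heads are equal or adjacent. The tail [s] is only required to stay at or below [n - 2], a
    condition that survives appending [n] and [n.+1] when the head becomes [v n.+3]. *)
Lemma sbracket_xv_homog n m s t w :
  (n <= m.+1)%N -> all (fun i => i + 2 <= n)%N s -> tail_shape t m ->
  (w + xdeg s + xdeg t = pdeg n + pdeg m)%N ->
  homog w (sbracket ((size s).+1 * (size t).+1) (xprod s * v n) (xprod t * v m)).
Proof.
move: {2}(m.+1 - n)%N (leqnn (m.+1 - n)%N) => k.
elim/ltn_ind: k n s => k IH n s knm nm sn tm wE.
have t2 := tail_shapeW tm.
have vmt l : (m <= l.+1)%N -> passes (v l) t.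
  by move=> lm; apply: v_passes; apply: sub_all t2 => i; lia.
have vms : (n <= m.+1)%N -> passes (v m) s.
  by move=> _; apply: v_passes; apply: sub_all sn => i; lia.
have [nm1|] := ltnP n m.-1; last first.
  move=> nm1; rewrite sbracket_passes; [|apply: vmt; lia|exact: vms].
  apply: homogZ.
  (* Adjacent heads give the first tail shape, equal heads the second. *)
  have [nE|[nE|nE]] : m = n.+1 \/ n = m \/ n = m.+1 by lia.
  - rewrite nE v_anticomm_succ mulrN; apply: homogN.
    rewrite mulrA -[x n]mulr1 -[1](xprod_nil) -xprod_cons -xprod_cat.
    apply: homog_xv; last first.
      by rewrite !xdeg_cat xdeg_cons xdeg_nil; move: (pdegE n) wE; rewrite nE; lia.
    apply/orP; left; rewrite !all_cat /= andbT -andbA; apply/and3P; split; last lia.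
      by apply: sub_all sn => i; lia.
    by apply: sub_all t2 => i; lia.
  - rewrite nE v_sqr -mulr2n -scaler_nat -scalerAr; apply: homogZ.
    rewrite mulrA -[x _]mulr1 -[1](xprod_nil) -xprod_cons -xprod_cat.
    apply: homog_xv; last first.
      by rewrite !xdeg_cat xdeg_cons xdeg_nil; move: (pdegE m) wE; rewrite nE; lia.
    apply/orP; right; rewrite !all_cat /= andbT -andbA; apply/and3P; split; last lia.
      by apply: sub_all sn => i; lia.
    by apply: sub_all t2 => i; lia.
  - rewrite nE addrC v_anticomm_succ mulrN; apply: homogN.
    rewrite mulrA -[x _]mulr1 -[1](xprod_nil) -xprod_cons -xprod_cat.
    apply: homog_xv; last first.
      by rewrite !xdeg_cat xdeg_cons xdeg_nil; move: (pdegE m) wE; rewrite nE; lia.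
    apply/orP; left; rewrite !all_cat /= andbT -andbA; apply/and3P; split; last lia.
      by apply: sub_all sn => i; lia.
    by apply: sub_all t2 => i; lia.
(* Here [n <= m - 2]: the [v n.+3] part falls under the induction hypothesis, and the [d n] part
   either strips [x n] from [t] or vanishes. *)
rewrite (vE n) mulrDr sbracketDl; apply: homogD; last first.
  have -> : xprod s * (x n * x n.+1 * v n.+3) = xprod (s ++ [:: n; n.+1]) * v n.+3.
    by rewrite xprod_cat !xprod_cons xprod_nil mulr1 !mulrA.
  rewrite (@sbracket_odd _ ((size (s ++ [:: n; n.+1])).+1 * (size t).+1)); last first.
    by rewrite size_cat addn2 !oddM /= !negbK.
  apply: (IH (m.+1 - n.+3)%N) => //; try lia.
    by rewrite all_cat /= andbT; apply/and3P; split; try lia; apply: sub_all sn => i; lia.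
  by rewrite xdeg_cat !xdeg_cons xdeg_nil pdegE; lia.
have [nt|nt] := boolP (n \in t); last first.
  rewrite sbracket_passes; [|exact: d_passes|exact: vms].
  by rewrite vd ?mulr0 ?scaler0; [constructor|lia].
case/splitPr: nt tm wE t2 {vmt} => t1 t2 tm wE tt.
have [nt|nt] := boolP (n \in t1 ++ t2).
  rewrite (@xprod_nuniq (t1 ++ n :: t2)) ?mul0r ?sbracket0r; first by constructor.
  by rewrite uniq_catC /= mem_cat orbC -mem_cat nt.
have -> : xprod (t1 ++ n :: t2) * v m = (-1) ^+ size t1 *: (x n * (xprod (t1 ++ t2) * v m)).
  rewrite !xprod_cat xprod_cons !mulrA (passes_mulx (@x_passes n t1)).
  by rewrite -!scalerAl signZK.
rewrite sbracketZr; apply: homogZ.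
rewrite size_cat /= addnS -size_cat.
move: tt; rewrite all_cat /= => /and3P[tt1 _ tt2].
rewrite sbracket_d_strip //; first last.
- by lia.
- by rewrite all_cat; apply/andP; split; [apply: sub_all tt1|apply: sub_all tt2] => i; lia.
- by apply: sub_all sn => i; lia.
apply: homog_xv; last first.
  by move: wE; rewrite !xdeg_cat xdeg_cons; lia.
move: tm; rewrite /tail_shape !all_cat /=.
(* Stripping the letter [m - 2] turns the second shape into the first, which leaves room for the
   letters of [s], all at most [m - 4]. In the other case the shape of [t] persists. *)
have [nE|nE] := eqVneq (n + 2)%N m.
  case/orP=> /and3P[h1 h2 h3]; first by lia.
  apply/orP; left; apply/and3P; split.
  - by apply: sub_all sn => i; lia.
  - apply/allP=> i it; have := allP h1 _ it; have : i != n; last by lia.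
    by apply: contraNneq nt => <-; rewrite mem_cat it.
  - apply/allP=> i it; have := allP h3 _ it; have : i != n; last by lia.
    by apply: contraNneq nt => <-; rewrite mem_cat it orbT.
case/orP=> /and3P[h1 h2 h3]; apply/orP; [left|right]; apply/and3P; split=> //;
  by apply: sub_all sn => i; lia.
Qed.

Lemma sbracket_homog w1 w2 y z : homog w1 y -> homog w2 z ->
  homog (w1 + w2) (sbracket (w1 * w2) y z).
Proof.
move=> Hy Hz; elim: Hy => [|c g k {}y ug gk wg _ IHy].
  by rewrite sbracket0l; constructor.
rewrite sbracketDl; apply: homogD IHy.
rewrite sbracketZl; apply: homogZ.
elim: Hz => [|c' g' k' {}z ug' gk' wg' _ IHz]; first by rewrite sbracket0r; constructor.
rewrite sbracketDr; apply: homogD IHz.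
rewrite sbracketZr; apply: homogZ.
(* The sign prescribed by the degrees is the one prescribed by the number of factors. *)
have par w u l : (w + xdeg u = pdeg l)%N -> odd w = odd (size u).+1.
  move=> /(congr1 odd); rewrite oddD odd_pdeg odd_xdeg /=.
  by case: (odd w); case: odd.
have parE : odd (w1 * w2) = odd ((size g).+1 * (size g').+1).
  by rewrite !oddM (par _ _ _ wg) (par _ _ _ wg').
rewrite (sbracket_odd _ _ parE).
have [kk|kk] := leqP k k'.+1.
  by apply: sbracket_xv_homog => //; [exact: tail_shapeW|lia].
rewrite sbracketC; apply: homogZ; rewrite mulnC.
by apply: sbracket_xv_homog => //; [lia|exact: tail_shapeW|lia].
Qed.

Lemma v_homog n : homog (pdeg n) (v n).
Proof.
rewrite -[v n]mul1r -(xprod_nil); apply: homog_xv; first by rewrite /tail_shape.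
by rewrite xdeg_nil addn0.
Qed.

(** The cross terms in the square of a sum are brackets, since [w] is odd; the diagonal terms reduce
    to [v_sqr]. *)
Lemma sqr_homog w y : 2%N \in [pchar K] -> odd w -> homog w y -> homog (w + w) (y * y).
Proof.
move=> K2 ow Hy.
have sb z u : z * u + u * z = sbracket (w * w) z u.
  rewrite /sbracket -[in RHS]signr_odd oddM ow expr1 scaleN1r opprK.
  by [].
elim: Hy => [|c g k {}y ug gk wg Hy IH]; first by rewrite mul0r; constructor.
rewrite mulrDl !mulrDr -addrA; apply: homogD; last first.
  rewrite addrA; apply: homogD IH; rewrite sb; apply: sbracket_homog => //.
  by apply: homogZ; apply: homog_xv.
rewrite -scalerAl -scalerAr; do 2!apply: homogZ.
have g2 := tail_shapeW gk.
have vg : passes (v k) g by apply: v_passes; apply: sub_all g2 => i; lia.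
rewrite -mulrA (mulrA (v k)) (passes_mulx vg) -scalerAl -scalerAr; apply: homogZ.
rewrite -mulrA v_sqr !mulrA -[x _]mulr1 -[1](xprod_nil) -xprod_cons -!xprod_cat.
apply: homog_xv; last by rewrite !xdeg_cat xdeg_cons xdeg_nil; move: (pdegE k); lia.
apply/orP; right; rewrite !all_cat /= andbT -andbA; apply/and3P; split; last lia.
  by apply: sub_all g2 => i; lia.
by apply: sub_all g2 => i; lia.
Qed.

(** * Lie monomials in the abstract algebra, and the elements they reach *)

Fixpoint lval (t : lmon) : A :=
  match t with
  | Gen i => v i
  | Br a b => sbracket (lmlen a * lmlen b) (lval a) (lval b)
  end.

Lemma lval_homog t : homog (lmlen t) (lval t).
Proof.
elim: t => [i|a Ha b Hb] /=; last exact: sbracket_homog.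
by have := v_homog i; case: i => -[|[|[|]]].
Qed.

Definition reached (s : seq nat) (n : nat) :=
  exists t e, lval t = (-1) ^+ e *: (xprod s * v n) /\
              (lmlen t + xdeg s = pdeg n)%N.

Lemma odd_weight w s n : (w + xdeg s = pdeg n)%N -> odd w = odd (size s).+1.
Proof.
move=> /(congr1 odd); rewrite oddD odd_pdeg odd_xdeg /=.
by case: (odd w); case: odd.
Qed.

(* The remaining part [x j * x j.+1 * v j.+3] of [v j] is killed by [x j]. *)
Lemma sbracket_v_strip j t n : all (fun i => i < n)%N t -> (j < n)%N -> j \notin t ->
  sbracket (size t).+2 (v j) (x j * (xprod t * v n)) = xprod t * v n.
Proof.
move=> tn jn jt; rewrite (vE j) sbracketDl.
have := @sbracket_d_strip j [::] t n isT tn jn jt.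
rewrite xprod_nil mul1r mul1n => ->.
rewrite /sbracket -[RHS]addr0; congr (_ + _).
have -> : x j * x j.+1 * v j.+3 * (x j * (xprod t * v n)) = 0.
  rewrite (mulrA _ (x j)) -(mulrA _ (v j.+3)) vx; last by lia.
  rewrite mulrN !mulrA -(mulrA (x j) (x j.+1) (x j)) (xx j.+1 j) mulrN mulrA xx0.
  by rewrite !(mul0r, oppr0, mulNr).
have -> : x j * (xprod t * v n) * (x j * x j.+1 * v j.+3) = 0.
  rewrite (mulrA (x j) (xprod t)) (passes_mulx (@x_passes j t)) -!scalerAl !mulrA.
  rewrite -(mulrA _ (v n)) vx // mulrN !mulNr !mulrA -(mulrA _ (x j) (x j)) xx0.
  by rewrite mulr0 !mul0r oppr0 scaler0.
by rewrite scaler0 subr0.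
Qed.

(** Bracketing [v n] with the bracket of [v n] and [v n.+1] strips [x n] from [- (x n * v n.+3)];
    the length obtained is the recursion for [pdeg]. *)
Lemma reached_v n : reached [::] n.
Proof.
elim/pdeg_ind3: n => [|||n [t [e [tE tl]]] [u [f [uE ul]]]].
- by exists (Gen (inord 0)), 0%N; rewrite xprod_nil xdeg_nil mul1r scale1r /= inordK.
- by exists (Gen (inord 1)), 0%N; rewrite xprod_nil xdeg_nil mul1r scale1r /= inordK.
- by exists (Gen (inord 2)), 0%N; rewrite xprod_nil xdeg_nil mul1r scale1r /= inordK.
move: tl ul; rewrite !xdeg_nil !addn0 => tl ul.
exists (Br t (Br t u)), (e + e + f).+1.
split; last by rewrite xdeg_nil pdegE [lmlen _]/= tl ul; lia.
rewrite /= tE uE !xprod_nil !mul1r !(sbracketZl, sbracketZr).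
have od := odd_pdeg.
have -> : sbracket (lmlen t * lmlen u) (v n) (v n.+1) = - (x n * v n.+3).
  by rewrite /sbracket -signr_odd oddM tl ul !od expr1 scaleN1r opprK v_anticomm_succ.
rewrite -scaleN1r sbracketZr.
have := @sbracket_v_strip n [::] n.+3 isT; rewrite !xprod_nil !mul1r => strip.
rewrite (@sbracket_odd _ 2); last by rewrite oddM oddD tl ul !od.
rewrite strip //; last by lia.
rewrite !signZD scalerA; congr (_ *: _).
by rewrite !exprS !exprD; ring.
Qed.

Lemma reached_strip s1 j s2 n : uniq (s1 ++ j :: s2) ->
  all (fun i => i < n)%N (s1 ++ j :: s2) ->
  reached (s1 ++ j :: s2) n -> reached (s1 ++ s2) n.
Proof.
rewrite uniq_catC /= mem_cat orbC -mem_cat => /andP[js _].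
rewrite all_cat /= => /and3P[sn1 jn sn2] [t [e [tE tl]]].
have [u [f [uE ul]]] := reached_v j.
exists (Br u t), (f + (e + size s1))%N; split; last first.
  by move: tl ul; rewrite !xdeg_cat xdeg_cons xdeg_nil /=; lia.
have ot := odd_weight tl; have ou := odd_weight ul.
rewrite /= (@sbracket_odd _ (size (s1 ++ s2)).+2); last first.
  by rewrite oddM ou ot /= !size_cat /= addnS.
rewrite tE uE xprod_nil mul1r sbracketZl sbracketZr.
have -> : xprod (s1 ++ j :: s2) * v n = (-1) ^+ size s1 *: (x j * (xprod (s1 ++ s2) * v n)).
  rewrite !xprod_cat xprod_cons !mulrA (passes_mulx (@x_passes j s1)).
  by rewrite -!scalerAl signZK.
by rewrite sbracketZr sbracket_v_strip ?signZD ?addnA ?all_cat ?sn1 ?sn2.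
Qed.

(** Unwanted letters are stripped one by one; [s1] accumulates the letters already kept. *)
Lemma reached_filter (P : pred nat) (s1 s : seq nat) n : uniq (s1 ++ s) ->
  all (fun i => i < n)%N (s1 ++ s) ->
  reached (s1 ++ s) n -> reached (s1 ++ [seq i <- s | P i]) n.
Proof.
elim: s s1 => [|j s IH] s1 //= us sn rs.
case: (P j).
  by rewrite -cat_rcons; apply: IH; rewrite ?cat_rcons.
apply: IH; last exact: reached_strip rs.
  by move: us; rewrite uniq_catC /= uniq_catC => /andP[].
by move: sn; rewrite !all_cat /= => /and3P[-> _ ->].
Qed.

(** Bracket with [v n]: its [d n] part contributes nothing, and its other part meets the adjacent
    heads [v n.+3] and [v n.+2], whose anticommutator is [- (x n.+2 * v n.+5)]. *)
Lemma reached_raise s n : all (fun i => i < n)%N s -> reached s n.+2 ->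
  reached ([:: n; n.+1] ++ s ++ [:: n.+2]) (n + 5).
Proof.
move=> sn [t [e [tE tl]]]; have [u [f [uE ul]]] := reached_v n.
exists (Br u t), (f + (e + (size s).+1))%N.
have -> : (n + 5 = n.+2.+3)%N by lia.
split; last first.
  move: tl ul; rewrite !xdeg_cat !xdeg_cons xdeg_nil !addn0 !pdegE [lmlen (Br _ _)]/=.
  by lia.
have ot := odd_weight tl; have ou := odd_weight ul.
rewrite /= tE uE xprod_nil mul1r sbracketZl sbracketZr -[RHS]signZD -[in RHS]signZD.
do 2!congr (_ *: _).
rewrite (vE n) sbracketDl.
have sn2 : passes (v n.+3) s by apply: v_passes; apply: sub_all sn => i; lia.
have ns : n \notin s by apply/negP => /(allP sn); rewrite ltnn.
rewrite (@sbracket_odd _ (1 * (size s).+1)); last by rewrite !oddM ot ou.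
have := @sbracket_passes [::] s (d n) (v n.+2) (d_passes ns) (fun _ => ltac:(done)).
rewrite vd // mulr0 scaler0 xprod_nil mul1r => ->; rewrite add0r.
rewrite (@sbracket_odd _ (3 * (size s).+1)); last by rewrite !oddM ot ou.
have := @sbracket_passes [:: n; n.+1] s (v n.+3) (v n.+2) sn2.
rewrite addrC v_anticomm_succ !xprod_cons xprod_nil mulr1 => ->; last first.
  by apply: v_passes; rewrite /= ltnS leqnSn ltnSn.
rewrite mulrN -scaleN1r scalerA exprSr; congr (_ *: _).
by rewrite !xprod_cat !xprod_cons xprod_nil mulr1 !mulrA.
Qed.

(** All letters below [3 * q], in the order in which [reached_raise] creates them. *)
Fixpoint top_tail (q : nat) : seq nat :=
  if q is q'.+1 then [:: (3 * q')%N; (3 * q').+1] ++ top_tail q' ++ [:: (3 * q').+2]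
  else [::].

Lemma perm_top_tail q : perm_eq (top_tail q) (iota 0 (3 * q)).
Proof.
elim: q => [|q IH] //; have -> : (3 * q.+1 = 3 * q + 3)%N by lia.
rewrite iotaD add0n [top_tail _]/= -[_ :: _ :: _]/([:: (3 * q)%N; (3 * q).+1] ++ _).
by rewrite perm_catC -catA perm_cat // -[iota _ _]cat0s perm_catC.
Qed.

Lemma mem_top_tail q i : (i \in top_tail q) = (i < 3 * q)%N.
Proof. by rewrite (perm_mem (perm_top_tail q)) mem_iota. Qed.

Lemma reached_top_tail q : reached (top_tail q) (3 * q).+2.
Proof.
elim: q => [|q IH]; first exact: reached_v.
have -> : (3 * q.+1).+2 = (3 * q + 5)%N by lia.
by apply: reached_raise IH; apply/allP=> i; rewrite mem_top_tail.
Qed.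

Lemma reached_sub_top_tail (P : pred nat) q :
  reached [seq i <- top_tail q | P i] (3 * q).+2.
Proof.
rewrite -[[seq _ <- _ | _]]cat0s; apply: reached_filter; rewrite ?cat0s.
- by rewrite (perm_uniq (perm_top_tail q)) iota_uniq.
- by apply/allP=> i; rewrite mem_top_tail; lia.
- exact: reached_top_tail.
Qed.

End PivotAlgebra.

(** * The algebra of linear endomorphisms of the Grassmann algebra *)

Section LinearEndomorphisms.
Variable K : fieldType.
Local Notation Lam := (Lam K).
Local Notation xmon := (@xmon K).

Lemma mcoeff_xmon S T : (xmon S)@_T = (S == T)%:R.
Proof. by rewrite /xmon mcoeffU. Qed.

Lemma xmon_expand (p : Lam) : p = \sum_(S <- msupp p) p@_S *: xmon S.
Proof.
rewrite {1}[p]monalgE; apply: eq_bigr => S _; apply/malgP => T.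
by rewrite mcoeffZ mcoeff_xmon mcoeffU mulr_natr.
Qed.

(** Allows sums for different vectors to be taken over one common support. *)
Lemma linextEw (f : {fset nat} -> Lam) (p : Lam) (D : {fset {fset nat}}) :
  (msupp p `<=` D)%fset -> linext f p = \sum_(S <- D) p@_S *: f S.
Proof.
move=> pD; apply: big_fset_incl => // S _ /mcoeff_outdom ->.
by rewrite scale0r.
Qed.

Lemma linext_linear (f : {fset nat} -> Lam) : linear (linext f).
Proof.
move=> a p q; pose D := (msupp p `|` msupp q `|` msupp (a *: p + q))%fset.
rewrite !(@linextEw f _ D);
  try by apply/fsubsetP => S; rewrite !in_fsetU => ->; rewrite ?orbT.
rewrite scaler_sumr -big_split; apply: eq_bigr => S _ /=.
by rewrite mcoeffD mcoeffZ scalerDl scalerA.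
Qed.

Lemma linext_xmon (f : {fset nat} -> Lam) S : linext f (xmon S) = f S.
Proof.
rewrite /linext msuppU oner_eq0 big_seq_fset1.
by rewrite mcoeffUU scale1r.
Qed.

(** Linearity is bundled because composition distributes over sums on the right only for linear
    maps. *)
Record endo := Endo { endo_fun :> Lam -> Lam; endo_linear : linear endo_fun }.

HB.instance Definition _ := gen_eqMixin endo.
HB.instance Definition _ := gen_choiceMixin endo.

Lemma endoP (f g : endo) : (forall p, f p = g p) -> f = g.
Proof.
case: f g => [f fl] [g gl] /= fg; have fgE : f = g by apply/funext.
by rewrite fgE in fl *; congr Endo; exact: Prop_irrelevance.
Qed.

HB.instance Definition _ (f : endo) :=
  GRing.isLinear.Build K Lam Lam *:%R f (endo_linear f).

Fact endo_zero_linear : linear (fun _ : Lam => 0 : Lam).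
Proof. by move=> a p q; rewrite scaler0 addr0. Qed.
Fact endo_add_linear (f g : endo) : linear (fun p => f p + g p).
Proof. by move=> a p q /=; rewrite !linearP scalerDr addrACA. Qed.
Fact endo_opp_linear (f : endo) : linear (fun p => - f p).
Proof. by move=> a p q /=; rewrite linearP opprD scalerN. Qed.
Fact endo_one_linear : linear (id : Lam -> Lam).
Proof. by []. Qed.
Fact endo_mul_linear (f g : endo) : linear (fun p => f (g p)).
Proof. by move=> a p q /=; rewrite !linearP. Qed.
Fact endo_scale_linear (c : K) (f : endo) : linear (fun p => c *: f p).
Proof. by move=> a p q /=; rewrite linearP scalerDr !scalerA mulrC. Qed.

Definition endo_zero := Endo endo_zero_linear.
Definition endo_add f g := Endo (endo_add_linear f g).
Definition endo_opp f := Endo (endo_opp_linear f).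
Definition endo_one := Endo endo_one_linear.
Definition endo_mul f g := Endo (endo_mul_linear f g).
Definition endo_scale c f := Endo (endo_scale_linear c f).

Fact endo_addA : associative endo_add.
Proof. by move=> f g h; apply: endoP => p /=; rewrite addrA. Qed.
Fact endo_addC : commutative endo_add.
Proof. by move=> f g; apply: endoP => p /=; rewrite addrC. Qed.
Fact endo_add0 : left_id endo_zero endo_add.
Proof. by move=> f; apply: endoP => p /=; rewrite add0r. Qed.
Fact endo_addN : left_inverse endo_zero endo_opp endo_add.
Proof. by move=> f; apply: endoP => p /=; rewrite addNr. Qed.
HB.instance Definition _ :=
  GRing.isZmodule.Build endo endo_addA endo_addC endo_add0 endo_addN.

Fact endo_mulA : associative endo_mul.
Proof. by move=> f g h; apply: endoP. Qed.
Fact endo_mul1l : left_id endo_one endo_mul.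
Proof. by move=> f; apply: endoP. Qed.
Fact endo_mul1r : right_id endo_one endo_mul.
Proof. by move=> f; apply: endoP. Qed.
Fact endo_mulDl : left_distributive endo_mul +%R.
Proof. by move=> f g h; apply: endoP. Qed.
Fact endo_mulDr : right_distributive endo_mul +%R.
Proof. by move=> f g h; apply: endoP => p /=; rewrite linearD. Qed.
Fact endo_one_neq0 : endo_one != 0.
Proof.
apply/eqP => /(congr1 (fun f : endo => (f (xmon fset0))@_fset0)) /=.
by rewrite mcoeff_xmon eqxx mcoeff0 => /eqP; rewrite oner_eq0.
Qed.
HB.instance Definition _ := GRing.Zmodule_isNzRing.Build endo
  endo_mulA endo_mul1l endo_mul1r endo_mulDl endo_mulDr endo_one_neq0.

Fact endo_scaleA a b f : endo_scale a (endo_scale b f) = endo_scale (a * b) f.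
Proof. by apply: endoP => p /=; rewrite scalerA. Qed.
Fact endo_scale1 : left_id 1 endo_scale.
Proof. by move=> f; apply: endoP => p /=; rewrite scale1r. Qed.
Fact endo_scaleDr : right_distributive endo_scale +%R.
Proof. by move=> c f g; apply: endoP => p /=; rewrite scalerDr. Qed.
Fact endo_scaleDl f : {morph endo_scale^~ f : a b / a + b}.
Proof. by move=> a b; apply: endoP => p /=; rewrite scalerDl. Qed.
HB.instance Definition _ := GRing.Zmodule_isLmodule.Build K endo
  endo_scaleA endo_scale1 endo_scaleDr endo_scaleDl.

Fact endo_scaleAl (c : K) (f g : endo) : c *: (f * g) = c *: f * g.
Proof. exact: endoP. Qed.
Fact endo_scaleAr (c : K) (f g : endo) : c *: (f * g) = f * (c *: g).
Proof. by apply: endoP => p; apply/esym; exact: linearZ. Qed.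
HB.instance Definition _ := GRing.Lmodule_isLalgebra.Build K endo endo_scaleAl.
HB.instance Definition _ := GRing.Lalgebra_isAlgebra.Build K endo endo_scaleAr.

End LinearEndomorphisms.

(* The endomorphism algebra is only used through this interface: unification
   must not see the functions behind its operations. *)
Record pivot_rep (K : fieldType) := PivotRep {
  rep_alg :> algType K;
  act : rep_alg -> Lam K -> Lam K;
  act_linear : forall f, linear (act f);
  actP : forall f g, (forall p, act f p = act g p) -> f = g;
  actD : forall f g p, act (f + g) p = act f p + act g p;
  actZ : forall c f p, act (c *: f) p = c *: act f p;
  actM : forall f g p, act (f * g) p = act f (act g p);
  act1 : forall p, act 1 p = p;
  xE : nat -> rep_alg;
  dE : nat -> rep_alg;
  vE : nat -> rep_alg;
  act_xE : forall i p, act (xE i) p = xop i p;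
  act_dE : forall i p, act (dE i) p = dop i p;
  act_vE : forall i p, act (vE i) p = pivot i p }.

Definition endo_rep (K : fieldType) : pivot_rep K :=
  @PivotRep K (endo K) (@endo_fun K) (@endo_linear K) (@endoP K)
    (fun _ _ _ => erefl) (fun _ _ _ => erefl) (fun _ _ _ => erefl) (fun _ => erefl)
    (fun i => Endo (@linext_linear K _ : linear (@xop K i)))
    (fun i => Endo (@linext_linear K _ : linear (@dop K i)))
    (fun i => Endo (@linext_linear K _ : linear (@pivot K i)))
    (fun _ _ => erefl) (fun _ _ => erefl) (fun _ _ => erefl).

(** * The concrete operators satisfy the pivot relations *)

Section PivotOperators.
Variables (K : fieldType) (r : pivot_rep K).
Local Notation Lam := (Lam K).
Local Notation xmon := (@xmon K).
Local Notation xE := (@xE K r).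
Local Notation dE := (@dE K r).
Local Notation vE := (@vE K r).
Local Notation act := (@act K r).
Implicit Types f g : r.

HB.instance Definition _ f :=
  GRing.isLinear.Build K Lam Lam *:%R (act f) (act_linear f).

Lemma act_xmonP f g : (forall S, act f (xmon S) = act g (xmon S)) -> f = g.
Proof.
move=> fg; apply: actP => p; rewrite [p]xmon_expand !linear_sum.
by apply: eq_bigr => S _; rewrite !linearZ /= fg.
Qed.

Lemma act_scale f c p : act f (c *: p) = c *: act f p.
Proof. exact: linearZ. Qed.

Lemma act_zero f : act f 0 = 0.
Proof. exact: linear0. Qed.

Lemma act_sum (I : Type) (s : seq I) f (F : I -> Lam) :
  act f (\sum_(i <- s) F i) = \sum_(i <- s) act f (F i).
Proof. exact: linear_sum. Qed.

Lemma actN f p : act (- f) p = - act f p.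
Proof. by rewrite -scaleN1r actZ scaleN1r. Qed.

Lemma act0 p : act 0 p = 0.
Proof. by rewrite -(scale0r (0 : r)) actZ scale0r. Qed.

Lemma xE_xmon i S : act (xE i) (xmon S) =
  if i \in S then 0 else (-1) ^+ nbefore i S *: xmon (i |` S)%fset.
Proof. by rewrite act_xE /xop linext_xmon. Qed.

Lemma dE_xmon i S : act (dE i) (xmon S) =
  if i \in S then (-1) ^+ nbefore i S *: xmon (S `\ i)%fset else 0.
Proof. by rewrite act_dE /dop linext_xmon. Qed.

Lemma vE_xmon i S : act (vE i) (xmon S) =
  \sum_(k < (\max_(s <- enum_fset S) s).+1) pref i k (dop (i + 3 * k) (xmon S)).
Proof. by rewrite act_vE /pivot linext_xmon. Qed.

Lemma nbefore_add i j (S : {fset nat}) : j \notin S ->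
  nbefore i (j |` S)%fset = ((j < i) + nbefore i S)%N.
Proof.
move=> jS; rewrite /nbefore -[RHS]/(count _ (j :: enum_fset S)).
apply/permP; apply: uniq_perm; rewrite /= ?fset_uniq ?andbT //.
by move=> k; rewrite !inE.
Qed.

Lemma nbefore_del i j (S : {fset nat}) : j \in S ->
  nbefore i S = ((j < i) + nbefore i (S `\ j)%fset)%N.
Proof. by move=> jS; rewrite -nbefore_add ?fsetD1K // !inE eqxx. Qed.

Lemma signZ_swap (V : lmodType K) a b a' b' (y : V) : odd (a + b) != odd (a' + b') ->
  (-1) ^+ a *: ((-1) ^+ b *: y) = - ((-1) ^+ a' *: ((-1) ^+ b' *: y)).
Proof.
rewrite !signZD -scaleN1r scalerA -exprS => H; apply: signZ_eq.
by rewrite /=; case: odd H; case: odd.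
Qed.

Lemma xE_sqr i : xE i * xE i = 0.
Proof.
apply: act_xmonP => S; rewrite actM xE_xmon act0; case: ifP => iS; first exact: act_zero.
by rewrite act_scale xE_xmon !inE eqxx scaler0.
Qed.

Lemma dE_sqr i : dE i * dE i = 0.
Proof.
apply: act_xmonP => S; rewrite actM dE_xmon act0; case: ifP => iS; last exact: act_zero.
by rewrite act_scale dE_xmon !inE eqxx scaler0.
Qed.

Lemma xE_anticomm i j : xE i * xE j = - (xE j * xE i).
Proof.
have [->|ij] := eqVneq i j; first by rewrite xE_sqr oppr0.
apply: act_xmonP => S; rewrite actN 2!actM 2!xE_xmon.
have [jS|jS] := boolP (j \in S); have [iS|iS] := boolP (i \in S).
- by rewrite 2!act_zero oppr0.
- by rewrite (act_zero (xE i)) act_scale xE_xmon !inE jS orbT scaler0 oppr0.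
- by rewrite (act_scale (xE i)) (act_zero (xE j)) xE_xmon !inE iS orbT scaler0 oppr0.
rewrite (act_scale (xE i)) (act_scale (xE j)) 2!xE_xmon !inE.
rewrite (negPf iS) (negPf jS) (eq_sym j) (negPf ij) (nbefore_add i jS) (nbefore_add j iS).
rewrite fsetUCA; apply: signZ_swap.
(* Exactly one of [i < j] and [j < i] holds, so the two orders of insertion differ by one sign. *)
by rewrite !oddD !oddb; case: ltngtP ij => // _ _; case: odd; case: odd.
Qed.

Lemma dE_anticomm i j : dE i * dE j = - (dE j * dE i).
Proof.
have [->|ij] := eqVneq i j; first by rewrite dE_sqr oppr0.
apply: act_xmonP => S; rewrite actN 2!actM 2!dE_xmon.
have [jS|jS] := boolP (j \in S); have [iS|iS] := boolP (i \in S).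
- rewrite (act_scale (dE i)) (act_scale (dE j)) 2!dE_xmon !inE.
  rewrite iS jS (eq_sym j) ij (nbefore_del j iS) (nbefore_del i jS).
  rewrite fsetDDl fsetUC -fsetDDl; apply: signZ_swap.
  by rewrite !oddD !oddb; case: ltngtP ij => // _ _; case: odd; case: odd.
- by rewrite (act_scale (dE i)) (act_zero (dE j)) dE_xmon !inE (negPf iS) andbF scaler0 oppr0.
- by rewrite (act_zero (dE i)) act_scale dE_xmon !inE (negPf jS) andbF scaler0 oppr0.
by rewrite 2!act_zero oppr0.
Qed.

Lemma dE_xE i j : i != j -> dE i * xE j = - (xE j * dE i).
Proof.
move=> ij; have ji : j != i by rewrite eq_sym.
apply: act_xmonP => S; rewrite actN 2!actM dE_xmon xE_xmon.
have [jS|jS] := boolP (j \in S); have [iS|iS] := boolP (i \in S).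
- by rewrite (act_zero (dE i)) act_scale xE_xmon !inE jS ji scaler0 oppr0.
- by rewrite 2!act_zero oppr0.
- rewrite (act_scale (dE i)) (act_scale (xE j)) dE_xmon xE_xmon !inE.
  rewrite (negPf jS) iS orbT andbF (nbefore_add i jS) (nbefore_del j iS).
  rewrite fsetDUl (_ : [fset j] `\ i = [fset j])%fset; last first.
    by apply/fsetP => k; rewrite !inE; case: eqP => // ->; rewrite (negPf ij).
  apply: signZ_swap; rewrite !oddD !oddb.
  by case: ltngtP ij => // _ _; case: odd; case: odd.
- rewrite (act_scale (dE i)) (act_zero (xE j)) dE_xmon !inE (negPf iS) (negPf ij).
  by rewrite scaler0 oppr0.
Qed.

Lemma dE_xE_eq i : dE i * xE i = 1 - xE i * dE i.
Proof.
apply: act_xmonP => S; rewrite actD actN 2!actM act1 dE_xmon xE_xmon.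
have [iS|iS] := boolP (i \in S).
  rewrite (act_zero (dE i)) act_scale xE_xmon !inE eqxx (fsetD1K iS).
  by rewrite {1}(nbefore_del i iS) ltnn add0n signZK subrr.
rewrite (act_scale (dE i)) (act_zero (xE i)) subr0 dE_xmon !inE eqxx.
by rewrite (nbefore_add i iS) ltnn add0n signZK (fsetU1K iS).
Qed.

(** The first [B] terms of the series for [v n]. This is a genuine element of the algebra, so
    identities are proved for it by induction and then transferred pointwise to [vE]. *)
Fixpoint vtrunc (B n : nat) : r :=
  if B is B'.+1 then dE n + xE n * xE n.+1 * vtrunc B' n.+3 else 0.

Lemma foldr_shift3 (T : Type) (F : nat -> T -> T) n k :
  foldr (fun m (h : T -> T) => F (n + 3 * m)%N \o F (n + 3 * m).+1 \o h) id (iota 1 k) =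
  foldr (fun m (h : T -> T) => F (n.+3 + 3 * m)%N \o F (n.+3 + 3 * m).+1 \o h) id (iota 0 k).
Proof.
rewrite -[1%N]/(1 + 0)%N iotaDl; elim: (iota 0 k) => //= m s ->.
by have -> : (n + 3 * (1 + m) = n.+3 + 3 * m)%N by lia.
Qed.

Lemma prefS n k p : pref n k.+1 p = xop n (xop n.+1 (@pref K n.+3 k p)).
Proof.
have -> : pref n.+3 k =
    foldr (fun m (h : Lam -> Lam) => xop (n + 3 * m)%N \o xop (n + 3 * m).+1 \o h)
    (@id Lam) (iota 1 k) by rewrite foldr_shift3.
by rewrite -{2 3}(addn0 n) -(muln0 3).
Qed.

Lemma vtruncE B n S :
  act (vtrunc B n) (xmon S) = \sum_(k < B) pref n k (dop (n + 3 * k) (xmon S)).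
Proof.
elim: B n => [|B IH] n; first by rewrite big_ord0 act0.
rewrite big_ord_recl muln0 addn0 [vtrunc _ _]/= actD 2!actM act_dE IH 2!act_sum.
congr (_ + _); apply: eq_bigr => k _; rewrite lift0 prefS act_xE act_xE.
by have -> : (n + 3 * k.+1 = n.+3 + 3 * k)%N by lia.
Qed.

(** The added term begins by applying the derivation of index [n + 3 * B], which kills a monomial
    with smaller letters only. *)
Lemma vtrunc_stable B n (S : {fset nat}) : (forall s, s \in S -> s < n + 3 * B)%N ->
  act (vtrunc B.+1 n) (xmon S) = act (vtrunc B n) (xmon S).
Proof.
elim: B n => [|B IH] n SB.
  rewrite [vtrunc 1 n]/= [vtrunc 0 n]/= actD 2!actM !act0 2!act_zero addr0 dE_xmon ifN //.
  by apply/negP => /SB; rewrite muln0 addn0 ltnn.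
rewrite [vtrunc B.+2 n]/= [vtrunc B.+1 n]/= 2!actD 4!actM -[dE n.+3 + _]/(vtrunc B.+1 n.+3).
by rewrite IH // => s /SB; lia.
Qed.

Lemma vE_trunc_xmon n S B : (\max_(s <- enum_fset S) s < B)%N ->
  act (vE n) (xmon S) = act (vtrunc B n) (xmon S).
Proof.
move=> SB; have -> : act (vE n) (xmon S) = act (vtrunc (\max_(s <- enum_fset S) s).+1 n) (xmon S).
  by rewrite vtruncE vE_xmon.
rewrite -(subnKC SB); elim: (B - _)%N => [|k IH]; first by rewrite addn0.
rewrite addnS IH; apply/esym; apply: vtrunc_stable => s sS.
have : (s <= \max_(s <- enum_fset S) s)%N by exact: leq_bigmax_seq.
by lia.
Qed.

Lemma vE_trunc n p : exists B0, forall B, (B0 <= B)%N -> act (vE n) p = act (vtrunc B n) p.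
Proof.
exists (\max_(S <- msupp p) (\max_(s <- enum_fset S) s).+1)%N => B pB.
rewrite [p]xmon_expand 2!act_sum; apply: eq_big_seq => S Sp.
rewrite 2!act_scale; congr (_ *: _); apply: vE_trunc_xmon.
apply: leq_trans pB.
exact: (@leq_bigmax_seq _ _ xpredT (fun S : {fset nat} => (\max_(s <- enum_fset S) s).+1)).
Qed.

Lemma vtrunc_xE B j n : (j < n)%N -> vtrunc B n * xE j = - (xE j * vtrunc B n).
Proof.
elim: B n => [|B IH] n jn /=; first by rewrite mul0r mulr0 oppr0.
rewrite mulrDl mulrDr dE_xE ?gtn_eqF // opprD; congr (_ + _).
rewrite -mulrA IH; last by lia.
rewrite mulrN !mulrA; congr (- (_ * _)).
by rewrite -(mulrA (xE n) (xE n.+1)) (xE_anticomm n.+1) mulrN mulrA (xE_anticomm n j) mulNr opprK.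
Qed.

Lemma vtrunc_dE B j n : (j < n)%N -> vtrunc B n * dE j = - (dE j * vtrunc B n).
Proof.
elim: B n => [|B IH] n jn /=; first by rewrite mul0r mulr0 oppr0.
rewrite mulrDl mulrDr (dE_anticomm n) opprD; congr (_ + _).
rewrite -mulrA IH; last by lia.
rewrite mulrN !mulrA; congr (- (_ * _)).
rewrite dE_xE; last by lia.
rewrite mulNr -(mulrA (xE n) (dE j)) dE_xE; last by lia.
by rewrite mulrN opprK mulrA.
Qed.

Lemma vE_xE j n : (j < n)%N -> vE n * xE j = - (xE j * vE n).
Proof.
move=> jn; apply: actP => p; rewrite actN !actM.
(* Two vectors are involved; [B1 + B2] is a truncation long enough for both. *)
have [B1 H1] := vE_trunc n p; have [B2 H2] := vE_trunc n (act (xE j) p).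
rewrite (H1 (B1 + B2)%N) ?leq_addr // (H2 (B1 + B2)%N) ?leq_addl //.
by rewrite -!actM -actN vtrunc_xE.
Qed.

Lemma dE_vE j n : (j < n)%N -> dE j * vE n + vE n * dE j = 0.
Proof.
move=> jn; apply: actP => p; rewrite actD !actM.
have [B1 H1] := vE_trunc n p; have [B2 H2] := vE_trunc n (act (dE j) p).
rewrite (H1 (B1 + B2)%N) ?leq_addr // (H2 (B1 + B2)%N) ?leq_addl //.
by rewrite -!actM -actD vtrunc_dE // subrr.
Qed.

Lemma vE_rec n : vE n = dE n + xE n * xE n.+1 * vE n.+3.
Proof.
apply: actP => p; rewrite actD !actM.
have [B1 H1] := vE_trunc n p; have [B2 H2] := vE_trunc n.+3 p.
(* One extra term on the left matches the term split off by the recursion. *)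
rewrite (H1 (B1 + B2).+1); last by lia.
by rewrite (H2 (B1 + B2)%N) ?leq_addl // /= actD !actM.
Qed.

Lemma lval_lmeval t p : act (lval vE t) p = lmeval t p.
Proof.
elim: t p => [i|a IHa b IHb] p /=; first by rewrite act_vE.
rewrite /sbr -2!IHa -2!IHb.
by rewrite /sbracket actD actN actZ 2!actM.
Qed.

Lemma xprod_one s : uniq s -> exists e,
  act (xprod xE s) (xmon fset0) = (-1) ^+ e *: xmon [fset i in s]%fset.
Proof.
elim: s => [|i s IH] /=.
  move=> _; exists 0%N; rewrite xprod_nil act1 expr0 scale1r; congr xmon.
  by apply/fsetP => j; rewrite !inE.
case/andP=> si /IH[e He]; exists (e + nbefore i [fset i in s]%fset)%N.
rewrite xprod_cons actM He act_scale xE_xmon !inE (negPf si) signZD; congr (_ *: xmon _).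
by apply/fsetP => j; rewrite !inE.
Qed.

(** Apply [vx_eq] to the unit of the Grassmann algebra, which [vE n] annihilates. Evaluation at this
    letter thus removes the head of a product and exposes its tail. *)
Lemma vE_top n : act (vE n) (xmon [fset n]%fset) = xmon fset0.
Proof.
have -> : xmon [fset n]%fset = act (xE n) (xmon fset0).
  by rewrite xE_xmon !inE fsetU0 /nbefore /= expr0 scale1r.
have v0 : act (vE n) (xmon fset0) = 0.
  rewrite (@vE_trunc_xmon n fset0 1) ?big_seq_fset0 // [vtrunc 1 n]/= actD 2!actM.
  by rewrite act0 2!act_zero addr0 dE_xmon in_fset0.
have := vx_eq xE_anticomm xE_sqr dE_xE_eq vE_rec vE_xE n.
move=> /(congr1 (fun f : r => act f (xmon fset0))).
by rewrite actD 2!actM act1 v0 act_zero addr0.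
Qed.

End PivotOperators.

(** * Bounding the dimension of the span of a finite family *)

Section Dimension.
Variable K : fieldType.

Lemma dependent_comb0 (V : lmodType K) n (J : finType) (M : 'M[K]_(n, #|J|))
    (u : 'rV[K]_n) (g : J -> V) (y : 'I_n -> V) :
  u *m M = 0 -> (forall i, y i = \sum_j M i (enum_rank j) *: g j) ->
  \sum_i u 0 i *: y i = 0.
Proof.
move=> uM yE; under eq_bigr => i _ do rewrite yE scaler_sumr.
rewrite exchange_big big1 // => j _.
under eq_bigr => i _ do rewrite scalerA.
rewrite -scaler_suml; have := congr1 (fun N : 'rV_#|J| => N 0 (enum_rank j)) uM.
by rewrite !mxE => ->; rewrite scale0r.
Qed.

Lemma nth_mask_iota (T : Type) (x0 : T) m (s : seq T) :
  mask m s = [seq nth x0 s i | i <- mask m (iota 0 (size s))].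
Proof. by rewrite map_mask -/(mkseq _ _) mkseq_nth. Qed.

(** An independent subfamily with more than [#|J|] members would have a coefficient matrix with more
    rows than columns; a vector in its left kernel is a forbidden relation. *)
Lemma dimspan_le (J : finType) (g : J -> Op K) (fs : seq (Op K)) :
  (forall i, (i < size fs)%N ->
     exists c : J -> K, forall p, nth id fs i p = \sum_j c j *: g j p) ->
  (dimspan fs <= #|J|)%N.
Proof.
move=> span; apply/bigmax_leqP => m /asboolP; rewrite (nth_mask_iota id).
set I := mask m _; rewrite size_map => indep.
have /choice[C CE] : forall i : 'I_(size I),
    exists c : J -> K, forall p, nth id fs (nth 0%N I i) p = \sum_j c j *: g j p.
  move=> i; apply: span; have := mem_nth 0%N (ltn_ord i).
  by move=> /mem_mask; rewrite mem_iota.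
rewrite leqNgt; apply/negP => Jlt.
pose M := \matrix_(i < size I, j < #|J|) C i (enum_val j).
have : kermx M != 0.
  rewrite kermx_eq0 /row_free neq_ltn; apply/orP; left.
  exact: leq_ltn_trans (rank_leq_col M) Jlt.
case/rowV0Pn=> u /sub_kermxP uM; apply/negP; rewrite negbK; apply/eqP/rowP => i.
rewrite mxE.
(* [linindep] takes coefficients indexed by all naturals, so the kernel vector is extended by 0. *)
pose c k := if insub k is Some k' then u 0 (k' : 'I_(size I)) else 0.
have cE (k : 'I_(size I)) : c k = u 0 k by rewrite /c valK.
rewrite -cE; apply: indep; last by rewrite size_map.
move=> p; rewrite size_map.
under eq_bigr => k _ do rewrite cE (nth_map 0%N) //.
apply: (dependent_comb0 (g := fun j => g j p) uM) => k.
by rewrite CE; apply: eq_bigr => j _; rewrite mxE enum_rankK.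
Qed.

Lemma dimspan_ge (J : finType) (pos : J -> nat) (fs : seq (Op K)) :
  (forall j, pos j < size fs)%N ->
  (forall c : J -> K, (forall p, \sum_j c j *: nth id fs (pos j) p = 0) ->
     forall j, c j = 0) ->
  (#|J| <= dimspan fs)%N.
Proof.
move=> posP indep.
have pos_inj : injective pos.
  move=> j k pjk; apply/eqP/negP => /negP jk.
  (* Two indices sharing a position would give a nontrivial relation. *)
  pose c i := (i == j)%:R - (i == k)%:R : K.
  have : c j = 0.
    apply: indep => p; under eq_bigr => i _ do rewrite scalerBl.
    rewrite sumrB (bigD1 j) //= [X in _ - X](bigD1 k) //= !eqxx !scale1r pjk.
    rewrite !big1 ?addr0 ?subrr // => i /negPf ->; exact: scale0r.
  by rewrite /c eqxx (negPf jk) subr0 => /eqP; rewrite oner_eq0.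
(* The mask keeps the chosen positions in increasing order, a permutation of the listing by [J];
   coefficients are transported along it. *)
pose m := [tuple (val i \in codom pos) | i < size fs].
pose I := mask m (iota 0 (size fs)).
have IE : I = [seq i <- iota 0 (size fs) | i \in codom pos].
  rewrite /I filter_mask; congr mask.
  by rewrite /m /= -[iota 0 _]val_enum_ord -map_comp ?val_ord_tuple.
have permI : perm_eq I [seq pos j | j <- enum J].
  apply: uniq_perm; first by rewrite IE filter_uniq // iota_uniq.
    by rewrite (map_inj_uniq pos_inj) enum_uniq.
  move=> i; rewrite IE mem_filter mem_iota add0n /=.
  by apply/andP/idP => [[] //|iJ]; split=> //; case/codomP: iJ => j ->.
have sI : size I = #|J| by rewrite (perm_size permI) size_map cardE.
have maskE : mask m fs = [seq nth id fs i | i <- I] by rewrite (nth_mask_iota id).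
have /leq_trans -> // : (#|J| <= size (mask m fs))%N by rewrite maskE size_map sI.
apply: (@leq_bigmax_cond _ _ (fun m : (size fs).-tuple bool => size (mask m fs))).
apply/asboolP; rewrite maskE => c; rewrite size_map => H i iI.
have uI : uniq I by rewrite IE filter_uniq // iota_uniq.
have cE : forall j, c (index (pos j) I) = 0.
  apply: indep => p; rewrite -[RHS](H p).
  rewrite -big_enum -(big_map pos xpredT (fun k => c (index k I) *: nth id fs k p)).
  rewrite -(perm_big _ permI) (big_nth 0%N) big_mkord.
  by apply: eq_bigr => k _; rewrite index_uniq // (nth_map 0%N).
have := mem_nth 0%N iI; rewrite (perm_mem permI) => /mapP[j _ Ij].
by rewrite -(cE j) -Ij index_uniq.
Qed.

End Dimension.

HB.instance Definition _ := gen_eqMixin lmon.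

Lemma lmlen_gt0 t : (0 < lmlen t)%N.
Proof. by elim: t => //= a Ha b Hb; rewrite addn_gt0 Ha. Qed.

(** Both halves of a bracket have positive length, so each is shorter than the whole and already
    listed one stage earlier. *)
Lemma mem_lmons n t : (t \in lmons n) = (lmlen t <= n)%N.
Proof.
elim: n t => [|n IH] t; first by rewrite in_nil leqNgt lmlen_gt0.
rewrite /= mem_cat mem_filter; apply/orP/idP => [[/mapP[i _ ->]|/andP[]]|] //.
case: t => [i|a b] tn; first by left; apply/mapP; exists i; rewrite ?mem_enum.
right; rewrite tn; apply: allpairs_f; rewrite IH; move: tn => /=.
  by have := lmlen_gt0 b; lia.
by have := lmlen_gt0 a; lia.
Qed.

Lemma card_set_ord m : #|{: {set 'I_m}}| = (2 ^ m)%N.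
Proof. by rewrite -cardsT -powersetT card_powerset cardsT card_ord. Qed.

(** * Upper and lower bounds for the growth function by powers of 2 *)

Section GrowthBounds.
Variables (K : fieldType) (r : pivot_rep K).
Local Notation xE := (@xE K r).
Local Notation dE := (@dE K r).
Local Notation vE := (@vE K r).
Local Notation act := (@act K r).

Lemma act_suml (I : Type) (s : seq I) (F : I -> r) p :
  act (\sum_(i <- s) F i) p = \sum_(i <- s) act (F i) p.
Proof. exact: (big_morph (act^~ p) (fun f g => actD f g p) (act0 r p)). Qed.

Lemma xprod_perm (s t : seq nat) : perm_eq s t ->
  exists e, xprod xE s = (-1) ^+ e *: xprod xE t.
Proof.
elim: s t => [|i s IH] t.
  by move=> /perm_size/esym/size0nil ->; exists 0%N; rewrite expr0 scale1r.
move=> st; have it : i \in t by rewrite -(perm_mem st) inE eqxx.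
case/splitPr: it st => t1 t2.
rewrite -[i :: t2]cat1s perm_sym perm_catCA /= perm_cons perm_sym => /IH[e He].
exists (size t1 + e)%N; rewrite xprod_cons He !xprod_cat xprod_cons.
rewrite (mulrA (xprod xE t1) (xE i)) -scalerAr (mulrA (xE i)).
by rewrite (passes_mulx (@x_passes _ _ _ (@xE_anticomm K r) i t1)) -scalerAl signZD addnC.
Qed.

Lemma growth_family_homog n y : y \in growth_family K n ->
  exists w f, [/\ (w <= n)%N, homog xE vE w f & forall p, y p = act f p].
Proof.
have hom t : homog xE vE (lmlen t) (lval vE t).
  exact: (lval_homog (@xE_anticomm K r) (@xE_sqr K r) (@dE_xE K r) (@dE_xE_eq K r)
    (@dE_sqr K r) (@vE_rec K r) (@vE_xE K r) (@dE_vE K r)).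
rewrite mem_cat => /orP[/mapP[t tn ->]|].
  exists (lmlen t), (lval vE t); split=> [||p]; first by rewrite -mem_lmons.
    exact: hom.
  by rewrite lval_lmeval.
case: ifP => // K2 /mapP[t]; rewrite mem_filter => /andP[/andP[ot t2] _] ->.
exists (lmlen t + lmlen t)%N, (lval vE t * lval vE t); split=> [||p].
- by rewrite addnn -mul2n.
- exact: (sqr_homog (@xE_anticomm K r) (@xE_sqr K r) (@dE_xE K r) (@dE_xE_eq K r)
    (@dE_sqr K r) (@vE_rec K r) (@vE_xE K r) (@dE_vE K r)).
- by rewrite actM !lval_lmeval.
Qed.

(* The set [T] encodes [xprod g * v k] through [T = k |: g], whose maximum is [k]. *)
Definition set_elt B (T : {set 'I_B}) : r :=
  let s := [seq val i | i <- enum T] in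
  let k := (\max_(i <- s) i)%N in xprod xE [seq i <- s | i != k] * vE k.

Lemma set_elt_span B g k : uniq g -> all (fun i => i < k)%N g -> (k < B)%N ->
  exists T : {set 'I_B}, exists e, xprod xE g * vE k = (-1) ^+ e *: set_elt T.
Proof.
move=> ug gk kB; exists [set i : 'I_B | val i \in k :: g].
rewrite /set_elt; set s := [seq val i | i <- _].
have sE i : (i \in s) = (i \in k :: g).
  apply/mapP/idP => [[j]|ikg]; first by rewrite mem_enum inE => jkg ->.
  have iB : (i < B)%N.
    by move: ikg; rewrite inE => /predU1P[-> //|/(allP gk)]; lia.
  by exists (Ordinal iB); rewrite ?mem_enum ?inE.
have -> : (\max_(i <- s) i)%N = k.
  apply/eqP; rewrite eqn_leq; apply/andP; split.
    by apply/bigmax_leqP_seq => i; rewrite sE inE => /predU1P[-> //|/(allP gk) /ltnW].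
  by apply: (@leq_bigmax_seq _ _ xpredT id); rewrite ?sE ?inE ?eqxx.
have kg : k \notin g by apply/negP => /(allP gk); rewrite ltnn.
have /xprod_perm[e ->] : perm_eq g [seq i <- s | i != k].
  apply: uniq_perm => //; first by rewrite filter_uniq // (map_inj_uniq val_inj) enum_uniq.
  move=> i; rewrite mem_filter sE inE; case: (eqVneq i k) => //= ->.
  exact: negbTE.
by exists e; rewrite -scalerAl.
Qed.

Lemma homog_span B w f :
  (forall g k, uniq g -> tail_shape g k -> (w + xdeg g = pdeg k)%N -> (k < B)%N) ->
  homog xE vE w f ->
  exists c : {set 'I_B} -> K, f = \sum_T c T *: set_elt T.
Proof.
move=> kB; elim=> [|a g k y ug gk wg _ [c ->]].
  by exists (fun=> 0); rewrite big1 // => T _; rewrite scale0r.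
have [T [e ->]] : exists T : {set 'I_B}, exists e, xprod xE g * vE k = (-1) ^+ e *: set_elt T.
  apply: set_elt_span => //; last exact: kB gk wg.
  by apply: sub_all (tail_shapeW gk) => i; lia.
exists (fun U => a * (-1) ^+ e *+ (U == T) + c U).
under [RHS]eq_bigr => U _ do rewrite scalerDl.
rewrite big_split; congr (_ + _).
rewrite (bigD1 T) //= eqxx mulr1n scalerA big1 ?addr0 // => U /negPf ->.
by rewrite mulr0n scale0r.
Qed.

(** If all heads in degree at most [n] have index below [B], the [2 ^ B] elements [set_elt T] span
    the whole family. *)
Lemma rep_gamma_le n B :
  (forall w g k, (w <= n)%N -> uniq g -> tail_shape g k ->
     (w + xdeg g = pdeg k)%N -> (k < B)%N) ->
  (gamma K n <= 2 ^ B)%N.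
Proof.
move=> kB; rewrite -card_set_ord.
apply: (@dimspan_le K _ (fun T => act (set_elt T))) => i iS.
have [w [f [wn hf fE]]] := growth_family_homog (mem_nth (id : Op K) iS).
have [c cE] := homog_span (fun g k => kB w g k wn) hf.
exists c => p; rewrite fE cE act_suml.
by apply: eq_bigr => T _; exact: actZ.
Qed.

(** Each subset of the letters below [3 * q] is the tail of a Lie monomial with head [v (3 * q).+2];
    evaluated at the letter of the head, these give distinct basis monomials up to sign. *)
Lemma rep_gamma_ge n q : (pdeg (3 * q).+2 <= n)%N -> (2 ^ (3 * q) <= gamma K n)%N.
Proof.
move=> qn; rewrite -card_set_ord.
pose tail (T : {set 'I_(3 * q)}) := [seq i <- top_tail q | i \in [seq val j | j <- enum T]].
have mem_tail T i : (i \in tail T) = (i \in [seq val j | j <- enum T]).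
  rewrite mem_filter mem_top_tail; apply: andb_idr => /mapP[j _ ->]; exact: ltn_ord.
have tail_uniq T : uniq (tail T).
  by rewrite filter_uniq // (perm_uniq (perm_top_tail q)) iota_uniq.
have tail_inj T U : [fset i in tail T]%fset = [fset i in tail U]%fset -> T = U.
  move=> /fsetP TU; apply/setP => i.
  have := TU (val i); rewrite !inE !mem_tail !(mem_map val_inj) !mem_enum.
  by [].
(* The pair holds a position in the growth family and a sign exponent. *)
have /choice[h hP] : forall T : {set 'I_(3 * q)}, exists ie : nat * nat,
    (ie.1 < size (growth_family K n))%N /\
    nth id (growth_family K n) ie.1 (xmon K [fset (3 * q).+2]%fset) =
    (-1) ^+ ie.2 *: xmon K [fset i in tail T]%fset.
  move=> T.
  have [t [e [tE tl]]] := reached_sub_top_tail (@xE_anticomm K r) (@xE_sqr K r)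
    (@dE_xE K r) (@dE_xE_eq K r) (@vE_rec K r) (@vE_xE K r) (@dE_vE K r)
    (fun i => i \in [seq val j | j <- enum T]) q.
  have tn : (lmlen t <= n)%N by apply: leq_trans qn; rewrite -tl leq_addr.
  have : lmeval t \in growth_family K n.
    by rewrite mem_cat map_f // mem_lmons.
  case/(nthP (id : Op K)) => i iS ti.
  have [e' He'] := xprod_one r (tail_uniq T).
  exists (i, e + e')%N; split=> //=; rewrite ti -(lval_lmeval r) tE actZ actM vE_top.
  by rewrite He' signZD.
apply: (@dimspan_ge K _ (fun T => (h T).1)) => [T|c H T]; first by case: (hP T).
have := congr1 (mcoeff [fset i in tail T]%fset) (H (xmon K [fset (3 * q).+2]%fset)).
rewrite raddf_sum mcoeff0 (bigD1 T) //= big1 ?addr0 => [|U UT]; last first.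
  case: (hP U) => _ ->; rewrite !mcoeffZ mcoeff_xmon.
  case: eqP => [/tail_inj UTE|_]; first by rewrite UTE eqxx in UT.
  by rewrite !mulr0.
case: (hP T) => _ ->; rewrite !mcoeffZ mcoeff_xmon eqxx mulr1 => /eqP.
by rewrite mulf_eq0 signr_eq0 orbF => /eqP.
Qed.

End GrowthBounds.

Lemma gamma_le (K : fieldType) n B :
  (forall w g k, (w <= n)%N -> uniq g -> tail_shape g k ->
     (w + xdeg g = pdeg k)%N -> (k < B)%N) ->
  (gamma K n <= 2 ^ B)%N.
Proof. exact: (rep_gamma_le (endo_rep K)). Qed.

Lemma gamma_ge (K : fieldType) n q :
  (pdeg (3 * q).+2 <= n)%N -> (2 ^ (3 * q) <= gamma K n)%N.
Proof. exact: (rep_gamma_ge (endo_rep K)). Qed.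

(** * Lower bounds for the degree of an element in terms of its head *)

Lemma xdeg_iota m : (2 * xdeg (iota 0 m) + 2 = pdeg m.+2 + pdeg m.+1)%N.
Proof.
elim: m => [|m IH]; first by rewrite xdeg_nil.
have -> : iota 0 m.+1 = iota 0 m ++ [:: m] by rewrite -{1}addn1 iotaD.
rewrite xdeg_cat xdeg_cons xdeg_nil (pdegE m).
by lia.
Qed.

Lemma xdeg_le_iota g m : uniq g -> all (fun i => i < m)%N g ->
  (xdeg g <= xdeg (iota 0 m))%N.
Proof.
move=> ug gm; have perm_g : perm_eq g [seq i <- iota 0 m | i \in g].
  apply: uniq_perm; rewrite // ?filter_uniq ?iota_uniq // => i.
  by rewrite mem_filter mem_iota add0n; apply/idP/andP => [ig|[]//]; rewrite ig (allP gm).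
rewrite /xdeg (perm_big _ perm_g) big_filter big_mkcond /=.
by apply: leq_sum => i _; case: ifP.
Qed.

(** The degree is least for the fullest tail: all letters below [k.+2] for the first shape, or all
    letters below [k] together with [k.+2] for the second. *)
Lemma weight_ge k g w : uniq g -> tail_shape g k.+4 -> (w + xdeg g = pdeg k.+4)%N ->
  (pdeg k.+4 + 2 <= 2 * w + pdeg k.+3)%N \/ (3 * pdeg k.+1 + 2 <= 2 * w + pdeg k.+2)%N.
Proof.
move=> ug /orP[] gk wE; [left|right].
  have : (xdeg g <= xdeg (iota 0 k.+2))%N.
    by apply: xdeg_le_iota => //; apply: sub_all gk => i; lia.
  by have := xdeg_iota k.+2; lia.
pose g' := [seq i <- g | i != k.+2].
have gg' : (xdeg g <= pdeg k.+2 + xdeg g')%N.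
  have [kg|kg] := boolP (k.+2 \in g).
    by rewrite /xdeg (big_rem _ kg) /= (rem_filter _ ug).
  rewrite /g' (_ : [seq i <- g | _] = g) ?leq_addl //.
  by apply/all_filterP/allP => i ig; apply: contraNneq kg => <-.
have : (xdeg g' <= xdeg (iota 0 k))%N.
  apply: xdeg_le_iota; first by rewrite filter_uniq.
  by apply/allP => i; rewrite mem_filter => /andP[ik /(allP gk)]; lia.
by have := xdeg_iota k; have := pdegE k.+1; lia.
Qed.

(** * Comparison with powers of [lambda] and passage to the limit *)

Section Asymptotics.
Variables (R : realType) (lambda : R).
Hypothesis lambda_root : lambda ^+ 3 - lambda - 2 = 0.

Lemma lambda_gt1 : 1 < lambda.
Proof.
rewrite ltNge; apply/negP => l1; have := lambda_root.
have [l0|l0] := leP 0 lambda; first by nra.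
have [lm|lm] := leP lambda (-1); nra.
Qed.

Lemma lambda_lt2 : lambda < 2.
Proof. by have l1 := lambda_gt1; rewrite ltNge; apply/negP => l2; have := lambda_root; nra. Qed.

Lemma lambdaX3 n : lambda ^+ n.+3 = lambda ^+ n.+1 + 2 * lambda ^+ n.
Proof.
have -> : lambda ^+ n.+3 = lambda ^+ 3 * lambda ^+ n by rewrite -exprD.
have -> : lambda ^+ 3 = lambda + 2 by have := lambda_root; lra.
by rewrite mulrDl -exprS.
Qed.

Lemma pdeg_natr n : (pdeg n.+3)%:R = (pdeg n.+1)%:R + 2 * (pdeg n)%:R :> R.
Proof. by rewrite (pdegE n) (natrD _ (pdeg n.+1)) natrM. Qed.

Lemma pdeg_le_lambdaX n : (pdeg n)%:R <= lambda ^+ n.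
Proof.
have l1 := lambda_gt1.
elim/pdeg_ind3: n => [|||n IH IH1].
- by [].
- by rewrite expr1 ltW.
- by rewrite exprn_ege1 // ltW.
by rewrite pdeg_natr lambdaX3; lra.
Qed.

(** Both sides obey the same recurrence with nonnegative coefficients, so three initial values
    decide; 2, 4 and 8 suffice because [lambda < 2]. *)
Lemma lambdaX_le_rec (u : nat -> R) :
  2 <= u 0%N -> 4 <= u 1%N -> 8 <= u 2%N ->
  (forall n, u n.+3 = u n.+1 + 2 * u n) -> forall n, 2 * lambda ^+ n <= u n.
Proof.
have l1 := lambda_gt1; have l2 := lambda_lt2.
move=> u0 u1 u2 uS n; elim/pdeg_ind3: n => [|||n IH IH1].
- by rewrite expr0; lra.
- by rewrite expr1; lra.
- by rewrite expr2; nra.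
by rewrite uS lambdaX3; lra.
Qed.

Lemma weight_ge_lambdaX j g w : uniq g -> tail_shape g j.+4.+4 ->
  (w + xdeg g = pdeg j.+4.+4)%N -> lambda ^+ j <= w%:R.
Proof.
move=> ug gk wg.
have two (b c : nat) : (c + 2 <= 2 * w + b)%N -> (c%:R - b%:R : R) <= 2 * w%:R.
  by rewrite -(ler_nat R) (natrD _ c) (natrD _ (2 * w)) natrM => ?; lra.
(* Each bound is a combination of shifted [pdeg], hence a solution of the recurrence. The shift by 8
   makes the initial values 8, 10, 12 and 6, 16, 14 large enough. *)
have [/two h|/two h] := weight_ge ug gk wg.
  pose u j : R := (pdeg j.+4.+4)%:R - (pdeg j.+4.+3)%:R.
  suff : 2 * lambda ^+ j <= u j by rewrite /u; lra.
  apply: lambdaX_le_rec.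
  - by rewrite /u (_ : pdeg 8 = 19%N) // (_ : pdeg 7 = 11%N) //; lra.
  - by rewrite /u (_ : pdeg 9 = 29%N) // (_ : pdeg 8 = 19%N) //; lra.
  - by rewrite /u (_ : pdeg 10 = 41%N) // (_ : pdeg 9 = 29%N) //; lra.
  by move=> n; rewrite /u (pdeg_natr n.+4.+4) (pdeg_natr n.+4.+3); lra.
pose u j : R := 3 * (pdeg j.+4.+1)%:R - (pdeg j.+4.+2)%:R.
suff : 2 * lambda ^+ j <= u j by move: h; rewrite /u natrM; lra.
apply: lambdaX_le_rec.
- by rewrite /u (_ : pdeg 5 = 5%N) // (_ : pdeg 6 = 9%N) //; lra.
- by rewrite /u (_ : pdeg 6 = 9%N) // (_ : pdeg 7 = 11%N) //; lra.
- by rewrite /u (_ : pdeg 7 = 11%N) // (_ : pdeg 8 = 19%N) //; lra.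
by move=> n; rewrite /u (pdeg_natr n.+4.+1) (pdeg_natr n.+4.+2); lra.
Qed.

(** A head of index at least [e + 9] would force degree at least [lambda ^+ e.+1], which exceeds
    [n]. *)
Lemma gamma_le_exp (K : fieldType) n e :
  n%:R < lambda ^+ e.+1 -> (gamma K n <= 2 ^ (e + 9))%N.
Proof.
move=> ne; apply: gamma_le => w g k wn ug gk wg.
rewrite ltnNge; apply/negP => ek.
have kE : k = (k - 8).+4.+4 by lia.
rewrite kE in gk wg; have := weight_ge_lambdaX ug gk wg.
apply/negP; rewrite -ltNge; apply: le_lt_trans (_ : n%:R < _); first by rewrite ler_nat.
apply: lt_le_trans ne _; apply: ler_weXn2l; last by lia.
exact: ltW lambda_gt1.
Qed.

Lemma gamma_ge_exp (K : fieldType) n e : (2 <= e)%N ->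
  lambda ^+ e <= n%:R -> (2 ^ (e - 4) <= gamma K n)%N.
Proof.
(* This is the largest [q] with [3 * q + 2 <= e]; rounding down costs at most 2, whence [e - 4]. *)
move=> e2 en; apply: (@leq_trans (2 ^ (3 * ((e - 2) %/ 3)))%N).
  by rewrite leq_exp2l //; lia.
apply: gamma_ge; rewrite -(ler_nat R).
apply: le_trans (pdeg_le_lambdaX _) _; apply: le_trans en.
apply: ler_weXn2l; last by lia.
exact: ltW lambda_gt1.
Qed.

Lemma ln_gamma_bounds (K : fieldType) n : lambda ^+ 3 <= n%:R ->
  `| ln 2 / ln lambda - ln ((gamma K n)%:R : R) / ln (n%:R : R) | <= 9 * ln 2 / ln n%:R.
Proof.
move=> n3; have l1 := lambda_gt1; have l0 : 0 < lambda by lra.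
have lnl : 0 < ln lambda by exact: ln_gt0.
have ln2 : 0 < ln (2 : R) by apply: ln_gt0; lra.
have n0 : 0 < n%:R :> R by apply: lt_le_trans n3; exact: exprn_gt0.
have lX e : ln (lambda ^+ e) = e%:R * ln lambda by rewrite lnXn // mulr_natl.
have n3l : 3 * ln lambda <= ln n%:R by rewrite -lX ler_ln // posrE exprn_gt0.
have lnn : 0 < ln (n%:R : R) by lra.
(* [y] is the logarithm of [n] to base [lambda] and [e] below is its integer part; [y >= 3] ensures
   [e >= 2]. *)
pose y : R := ln n%:R / ln lambda; have yE : ln n%:R = y * ln lambda.
  by rewrite /y divfK // gt_eqF.
have y3 : 3 <= y by rewrite /y ler_pdivlMr.
have y0 : 0 <= y by lra.
have := truncn_itv y0; set e := Num.Def.trunc y => /andP[ey ye].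
have e2 : (2 <= e)%N by rewrite -ltnS -(ltr_nat R); lra.
have upper : ln (gamma K n)%:R <= (y + 9) * ln 2.
  have g1 : (gamma K n <= 2 ^ (e + 9))%N.
    apply: gamma_le_exp; rewrite -ltr_ln ?posrE ?exprn_gt0 // lX yE.
    by rewrite ltr_pM2r.
  have [->|g0] := posnP (gamma K n).
    by rewrite ln0 //; apply: mulr_ge0; lra.
  apply: (@le_trans _ _ (ln ((2 : R) ^+ (e + 9)))).
    rewrite ler_ln ?posrE ?exprn_gt0 ?ltr0n //.
    by rewrite -natrX ler_nat.
  by rewrite lnXn // -[leLHS]mulr_natl ler_pM2r // natrD; lra.
(* The loss of 5 is 4 from [gamma_ge_exp] and less than 1 from the integer part. *)
have lower : (y - 5) * ln 2 <= ln (gamma K n)%:R.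
  have g1 : (2 ^ (e - 4) <= gamma K n)%N.
    apply: gamma_ge_exp => //; rewrite -ler_ln ?posrE ?exprn_gt0 // lX yE.
    by rewrite ler_pM2r.
  have g0 : (0 < gamma K n)%N by apply: leq_trans g1; rewrite expn_gt0.
  apply: (@le_trans _ _ (ln ((2 : R) ^+ (e - 4)))); last first.
    rewrite ler_ln ?posrE ?exprn_gt0 ?ltr0n //.
    by rewrite -natrX ler_nat.
  rewrite lnXn // -[leRHS]mulr_natl ler_pM2r //.
  have : (e <= (e - 4) + 4)%N by rewrite addnC -leq_subLR.
  by rewrite -(ler_nat R) natrD; move: ye; rewrite -natr1; lra.
have -> : ln 2 / ln lambda - ln (gamma K n)%:R / ln n%:R =
    (y * ln 2 - ln (gamma K n)%:R) / ln n%:R.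
  by rewrite yE; field; rewrite !gt_eqF //; lra.
rewrite normrM [ `|(ln _)^-1| ]gtr0_norm ?invr_gt0 // ler_pM2r ?invr_gt0 //.
by rewrite ler_norml; lra.
Qed.

Lemma ln_gamma_cvg (K : fieldType) :
  (ln ((gamma K n)%:R : R) / ln (n%:R : R) @[n --> \oo] --> ln 2 / ln lambda)%classic.
Proof.
apply/cvgrPdist_le => eps eps0; near=> n.
have n3 : lambda ^+ 3 <= n%:R by near: n; apply: nbhs_infty_ger.
apply: le_trans (ln_gamma_bounds K n3) _.
have ln2 : 0 < ln (2 : R) by apply: ln_gt0; lra.
(* Beyond this threshold the error [9 * ln 2 / ln n] is at most [eps]. *)
have nE : expR (9 * ln 2 / eps) <= n%:R by near: n; apply: nbhs_infty_ger.
have ne : 9 * ln 2 / eps <= ln n%:R.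
  rewrite -[leLHS]expRK ler_ln ?posrE ?expR_gt0 //.
  exact: lt_le_trans (expR_gt0 _) nE.
have lnn : 0 < ln (n%:R : R).
  by apply: lt_le_trans ne; rewrite divr_gt0 //; lra.
by rewrite ler_pdivrMr // (mulrC eps) -ler_pdivrMr.
Unshelve. all: by end_near. Qed.

End Asymptotics.

Theorem theorem8p4 (K : fieldType) (R : realType) (lambda : R) :
  lambda ^+ 3 - lambda - 2 = 0 ->
  GKdim K R = (ln 2 / ln lambda)%:E /\ lower_GKdim K R = (ln 2 / ln lambda)%:E.
Proof.
(* The quotient has a true limit, so its upper and lower limits coincide with it. *)
move=> root; have cvgE : ((ln ((gamma K n)%:R : R) / ln (n%:R : R))%:E @[n --> \oo]
    --> (ln 2 / ln lambda)%:E)%classic.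
  by apply: cvg_EFin; [exact: nearW|exact: ln_gamma_cvg].
by have [einf esup] := cvg_limn_einf_sup cvgE.
Qed.
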